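(* Let $h:\mathbb R^n\to\mathbb R\cup\{\infty\}$ be a Legendre kernel with $C:=\operatorname{int}\operatorname{dom}h$, let $f:\mathbb R^n\to\mathbb R\cup\{\infty\}$ be $L_f$-smooth relative to $h$, let $g:\mathbb R^n\to\mathbb R\cup\{\infty\}$ be proper and lsc, let $\varphi=f+g$ satisfy $\operatorname*{argmin}_{\overline C}\varphi\ne\emptyset$, and assume $\operatorname{range}T_{\gamma}\subseteq C$ for $\gamma\in(0,1/L_f)$. Let $\gamma\in(0,1/L_f)$ and let $x_\star$ be a nondegenerate fixed point of $T_\gamma$ (that is, $T_\gamma(x_\star)=\{x_\star\}$) at which $g$ is prox-regular for $-\nabla f(x_\star)$. Suppose further that $f,h\in\mathcal C^2(C)$ with $\nabla^2h\succ0$, and that $\Phi_\gamma$ has the KL property at $x_\star$ with desingularizing function $\psi$. Then, denoting $\varphi_\star:=\Phi_\gamma(x_\star)$, there exist $\varepsilon,\eta>0$ such that $$\psi\big(\Phi_\gamma(x)-\varphi_\star\big)\ \ge\ \operatorname{dist}\big(x,[\Phi_\gamma\le\varphi_\star]\big)$$ for all $x\in B(x_\star;\varepsilon)$ such that $\varphi_\star<\Phi_\gamma(x)<\varphi_\star+\eta$.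
   Context: A Legendre kernel is a proper, lsc, convex function $h:\mathbb R^n\to\mathbb R\cup\{\infty\}$ with $\operatorname{int}\operatorname{dom}h\ne\emptyset$, $h\in\mathcal C^1(\operatorname{int}\operatorname{dom}h)$, that is strictly convex, essentially smooth ($\|\nabla h(x_k)\|\to\infty$ for every sequence in $\operatorname{int}\operatorname{dom}h$ converging to a boundary point of $\operatorname{dom}h$), and $1$-coercive ($\lim_{\|x\|\to\infty}h(x)/\|x\|=\infty$). Bregman distance: $\mathrm D_h(x,y)=h(x)-h(y)-\langle\nabla h(y),x-y\rangle$ if $y\in\operatorname{int}\operatorname{dom}h$, and $\infty$ otherwise. A proper lsc $f$ is $L_f$-smooth relative to $h$ ($L_f\ge0$) if $\operatorname{dom}f\supseteq\operatorname{dom}h$ and $L_fh\pm f$ are convex on $\operatorname{int}\operatorname{dom}h$; $1/L_f:=\infty$ if $L_f=0$. Bregman forward-backward map and envelope: $T_\gamma(x)=\operatorname*{argmin}_z\{f(x)+\langle\nabla f(x),z-x\rangle+g(z)+\frac1\gamma \mathrm D_h(z,x)\}$, and $\Phi_\gamma(x)$ is the infimum of the same expression over $z\in\mathbb R^n$. $[F\le\alpha]=\{x:F(x)\le\alpha\}$. $\partial$ is the limiting (Mordukhovich) subdifferential. $g$ is prox-regular at $\bar x$ for $\bar v\in\partial g(\bar x)$ if it is locally lsc at $\bar x$ and there are $r,\varepsilon>0$ such that $g(x')\ge g(x)+\langle v,x'-x\rangle-\frac r2\|x'-x\|^2$ for all $x,x'\in B(\bar x;\varepsilon)$ and $v\in\partial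 g(x)$ with $v\in B(\bar v;\varepsilon)$ and $g(x)\le g(\bar x)+\varepsilon$. $F$ has the KL property at $u_\star\in\operatorname{dom}F$ with desingularizing function $\psi$ if $\psi:[0,\eta]\to[0,\infty)$ (for some $\eta>0$) is concave, $\psi(0)=0$, $\psi\in\mathcal C^1((0,\eta))$, and for some $\varepsilon>0$, $\psi'(F(u)-F(u_\star))\operatorname{dist}(0,\partial F(u))\ge1$ for all $u\in B(u_\star;\varepsilon)$ with $F(u_\star)<F(u)<F(u_\star)+\eta$. *)

(* Defs.v *)
From HB Require Import structures.
From mathcomp Require Import all_boot all_order all_algebra.
From mathcomp Require Import all_classical all_reals all_analysis.

Set Implicit Arguments.
Unset Strict Implicit.
Unset Printing Implicit Defensive.

Import Order.TTheory GRing.Theory Num.Theory.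
Import numFieldNormedType.Exports.

Local Open Scope classical_set_scope.
Local Open Scope ring_scope.

Section Euclidean.
Context {R : realType} {n : nat}.
Implicit Types (x y : 'rV[R]_n) (A : set 'rV[R]_n).

Definition dotv x y : R := \sum_(i < n) x ord0 i * y ord0 i.

(* The library norm `|x| on 'rV[R]_n is the max norm: it induces the right
   topology, but every metric quantity below uses the Euclidean norm. *)
Definition enorm x : R := Num.sqrt (dotv x x).

Definition eball x (r : R) : set 'rV[R]_n := [set y | enorm (y - x) < r].

Definition eclosed_ball x (r : R) : set 'rV[R]_n :=
  [set y | enorm (y - x) <= r].

(* Equal to +oo when A is empty. *)
Definition set_dist x A : \bar R := ereal_inf [set (enorm (x - y))%:E | y in A].

Definition posdefmx (M : 'M[R]_n) : Prop :=
  M^T = M /\ forall u : 'rV[R]_n, u != 0 -> 0 < dotv (u *m M) u.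

End Euclidean.

Section Smoothness.
Context {R : realType}.

(* Meant for open sets U. *)
Definition C1_on (V W : normedModType R) (U : set V) (F : V -> W) : Prop :=
  forall x, U x ->
    differentiable F x /\ forall v : V, {for x, continuous (fun y => 'D_v F y)}.

Definition C2_on (V W : normedModType R) (U : set V) (F : V -> W) : Prop :=
  C1_on U F /\ forall v : V, C1_on U (fun y => 'D_v F y).

End Smoothness.

Section ExtendedValued.
Context {R : realType} {n : nat}.
Implicit Types (F : 'rV[R]_n -> \bar R) (x : 'rV[R]_n) (A : set 'rV[R]_n).

Definition dom F : set 'rV[R]_n := [set x | (F x < +oo)%E].

Definition proper_fun F : Prop :=
  (forall x, F x != -oo%E) /\ exists x, (F x < +oo)%E.

Definition econvex F : Prop :=
  forall x y (t : R), 0 < t -> t < 1 ->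
    (F (t *: x + (1 - t) *: y)%R
     <= t%:E * F x + (1 - t)%:E * F y)%E.

Definition strictly_econvex F : Prop :=
  forall x y (t : R), dom F x -> dom F y -> x != y -> 0 < t -> t < 1 ->
    (F (t *: x + (1 - t) *: y)%R
     < t%:E * F x + (1 - t)%:E * F y)%E.

(* grad and hess are only used at interior points of dom F, around which F is
   finite, so that `fine` loses no information. *)
Definition grad F x : 'rV[R]_n :=
  \row_i 'D_(delta_mx ord0 i) (fine \o F) x.

Definition hess F x : 'M[R]_n :=
  \matrix_(i, j)
    'D_(delta_mx ord0 i) (fun y => 'D_(delta_mx ord0 j) (fine \o F) y) x.

(* Minimizers are required to lie in dom F: argmin is empty if F is
   identically +oo on A. *)
Definition argmin A F : set 'rV[R]_n :=
  [set x | [/\ A x, (F x < +oo)%E & forall y, A y -> (F x <= F y)%E]].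

Definition sublevel F (a : \bar R) : set 'rV[R]_n := [set x | (F x <= a)%E].

(* v is a regular (Frechet) subgradient of F at x:
   F z >= F x + <v, z - x> + o(|z - x|). *)
Definition regular_subdiff F x : set 'rV[R]_n :=
  [set v | F x \is a fin_num /\
    forall e : R, 0 < e ->
      \forall z \near x,
        (F x + (dotv v (z - x) - e * enorm (z - x))%:E <= F z)%E].

Definition limiting_subdiff F x : set 'rV[R]_n :=
  [set v | F x \is a fin_num /\
    exists (u w : nat -> 'rV[R]_n),
      [/\ u @ \oo --> x,
          F (u k) @[k --> \oo] --> F x,
          (forall k, regular_subdiff F (u k) (w k)) &
          w @ \oo --> v]].

(* Rockafellar--Wets, Variational Analysis, Def. 1.33. *)
Definition locally_lsc F x : Prop :=
  F x \is a fin_num /\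
  exists2 e : R, 0 < e &
    forall a : R, (a%:E <= F x + e%:E)%E ->
      closed (eclosed_ball x e `&` sublevel F a%:E).

Definition prox_regular F (xb vb : 'rV[R]_n) : Prop :=
  [/\ limiting_subdiff F xb vb,
      locally_lsc F xb &
      exists r e : R, [/\ 0 < r, 0 < e &
        forall x x' v, eball xb e x -> eball xb e x' ->
          limiting_subdiff F x v -> eball vb e v ->
          (F x <= F xb + e%:E)%E ->
          (F x + (dotv v (x' - x) - r / 2 * enorm (x' - x) ^+ 2)%:E
           <= F x')%E]].

(* psi : [0, eta] -> [0, +oo[ is represented by a total function, whose values
   outside [0, eta] are unconstrained and irrelevant. *)
Definition desingularizing (eta : R) (psi : R -> R) : Prop :=
  [/\ psi 0 = 0,
      (forall s, 0 <= s <= eta -> 0 <= psi s),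
      convex_function (`[0, eta] : set R^o) (fun s : R^o => - psi s : R^o) &
      C1_on (`]0, eta[ : set R^o) (psi : R^o -> R^o)].

Definition KL_property F (us : 'rV[R]_n) (psi : R -> R) : Prop :=
  dom F us /\
  exists eta : R, [/\ 0 < eta, desingularizing eta psi &
    exists2 e : R, 0 < e &
      forall u, eball us e u -> (F us < F u)%E -> (F u < F us + eta%:E)%E ->
        (1 <= ((psi^`()%classic (fine (F u - F us)%E))%:E
               * set_dist 0 (limiting_subdiff F u)))%E].

End ExtendedValued.

Section Bregman.
Context {R : realType} {n : nat}.
Implicit Types (h f g F : 'rV[R]_n -> \bar R) (x y z : 'rV[R]_n).

Definition one_coercive F : Prop :=
  forall M : R, exists2 r : R, 0 < r &
    forall x, r < enorm x -> (M%:E <= F x / (enorm x)%:E)%E.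

Definition essentially_smooth h : Prop :=
  forall (u : nat -> 'rV[R]_n) x,
    (forall k, (dom h)° (u k)) ->
    (closure (dom h) `\` (dom h)°) x ->
    u @ \oo --> x ->
    enorm (grad h (u k)) @[k --> \oo] --> +oo.

Record legendre_kernel h : Prop := LegendreKernel {
  legendre_proper : proper_fun h;
  legendre_lsc : lower_semicontinuous h;
  legendre_convex : econvex h;
  legendre_int_dom : (dom h)° !=set0;
  legendre_C1 : C1_on (dom h)° (fine \o h);
  legendre_strict : strictly_econvex h;
  legendre_ess_smooth : essentially_smooth h;
  legendre_coercive : one_coercive h
}.

Definition bregman h x y : \bar R :=
  if `[< (dom h)° y >]
  then (h x - h y - (dotv (grad h y) (x - y))%:E)%E
  else +oo%E.

(* Both h and f are finite on the interior of dom h. *)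
Record rel_smooth (L : R) f h : Prop := RelSmooth {
  rel_smooth_ge0 : 0 <= L;
  rel_smooth_proper : proper_fun f;
  rel_smooth_lsc : lower_semicontinuous f;
  rel_smooth_dom : dom h `<=` dom f;
  rel_smooth_add :
    convex_function (dom h)° (fun x => L * fine (h x) + fine (f x) : R^o);
  rel_smooth_sub :
    convex_function (dom h)° (fun x => L * fine (h x) - fine (f x) : R^o)
}.

(* Identically +oo in z when x is not in the interior of dom h (f and g never
   take the value -oo), whatever the junk value of grad f x. *)
Definition bfb_model f g h (gamma : R) x z : \bar R :=
  (f x + (dotv (grad f x) (z - x))%:E + g z
   + (gamma^-1)%:E * bregman h z x)%E.

Definition bfb_map f g h gamma x : set 'rV[R]_n :=
  argmin setT (bfb_model f g h gamma x).

Definition bfb_envelope f g h gamma x : \bar R :=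
  ereal_inf (range (bfb_model f g h gamma x)).

End Bregman.

(* Main.v *)
(** A point x at which the conclusion fails satisfies
    psi(Phi x - Phi_star) < lam d with lam < 1, where d is the distance from x
    to the sublevel set. Minimise psi(Phi - Phi_star), with Phi truncated to
    the interval [Phi_star, Phi x], plus lam times a smoothed distance to x over
    the closed ball of radius d around x. The minimiser u is interior to the
    ball and lies outside the sublevel set, and there concavity of psi turns
    minimality into a regular subgradient v of Phi with
    psi'(Phi u - Phi_star) |v| <= lam < 1, against the KL inequality.
    This only needs Phi finite and lower semicontinuous near x_star. On
    int dom h one has Phi x = inf_z (a x + <b x, z> + k z), with k = g + h/gamma
    independent of x and a, b continuous, and relative smoothness of f together
    with 1-coercivity of h makes the function of z grow at least like |z|, so a
    small perturbation of (a x, b x) lowers the infimum only slightly. *)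
Require Import Defs.
From mathcomp Require Import all_boot all_order all_algebra.
From mathcomp Require Import all_classical all_reals all_analysis.
From mathcomp Require Import ring lra.
Import Order.TTheory GRing.Theory Num.Theory.
Import numFieldNormedType.Exports.
Local Open Scope classical_set_scope.
Local Open Scope ring_scope.

(** * Convexity on segments, tangents of concave functions, attained minima *)

Lemma convex_on_segment (R : realType) (E : lmodType R) (D : set E)
    (F : E -> R) (x y : E) (t : R) :
  convex_function (D : set (convex_lmodType E)) (F : convex_lmodType E -> R^o) ->
  D x -> D y -> 0 < t -> t < 1 ->
  F (t *: x + (1 - t) *: y) <= t * F x + (1 - t) * F y.
Proof.
move=> cF Dx Dy t0 t1.
have t01 : 0 <= t <= 1 by rewrite !ltW.
exact: (cF (Itv01 (ltW t0) (ltW t1)) x y (mem_set Dx) (mem_set Dy)).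
Qed.

(** If the derivative exceeded [D], so would the difference quotient at some small [t > 0]. Gradient
    inequalities for [- psi], [h] and [L h - f] all come from here. *)
Lemma derive_le_secant (R : realType) (V : normedModType R) (F : V -> R)
    (x v : V) (D : R) :
  derivable F x v ->
  (forall t, 0 < t -> t < 1 -> F (t *: v + x) <= F x + t * D) ->
  'D_v F x <= D.
Proof.
move=> dF slope; rewrite leNgt; apply/negP => ltD.
have /cvgr_gt/(_ _ ltD) : (fun t : R => t^-1 *: ((F \o shift x) (t *: v) - F x))
    @ 0^' --> 'D_v F x by exact: dF.
move=> /nbhs_ballP[e /= e0 near0].
pose t := Num.min e 1 / 2.
have m0 : 0 < Num.min e 1 by rewrite lt_min e0 ltr01.
have t0 : 0 < t by rewrite divr_gt0.
have tm : t < Num.min e 1 by rewrite ltr_pdivrMr// ltr_pMr// ltr1n.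
have /andP[te t1] : (t < e) && (t < 1) by rewrite -lt_min.
have : D < t^-1 *: (F (t *: v + x) - F x).
  apply: near0; last by rewrite gt_eqF.
  by rewrite /ball_ /ball /= sub0r normrN gtr0_norm.
rewrite ltNge /GRing.scale/= mulrC ler_pdivrMr//.
by rewrite lerBlDl [D * t]mulrC slope.
Qed.

Section Desingularizing.
Context {R : realType} (eta : R) (psi : R -> R)
  (psi_desing : desingularizing eta psi).

(** Concavity puts the graph below its tangent at an interior point [a]; [s] may be an endpoint,
    where [psi] can fail to be differentiable. *)
Lemma desingularizing_tangent (a s : R) :
  0 < a < eta -> 0 <= s <= eta -> psi s <= psi a + psi^`()%classic a * (s - a).
Proof.
case: psi_desing => _ _ cpsi C1psi /andP[a0 aeta] s0eta.
have dpsi : differentiable (psi : R^o -> R^o) a.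
  by have [] := C1psi a; rewrite /= ?in_itv /= ?a0.
have der u : derivable (psi : R^o -> R^o) a u by exact: diff_derivable.
have De : 'D_(s - a) (psi : R^o -> R^o) a = psi^`()%classic a * (s - a).
  rewrite derive1E !deriveE//.
  rewrite -[X in 'd _ _ X](mulr1 (s - a)) -/((s - a) *: (1 : R^o)) linearZ/=.
  by rewrite mulrC.
have derN : derivable (fun s : R^o => - psi s : R^o) a (s - a).
  exact: (derivableN (der _)).
suff : 'D_(s - a) (fun s : R^o => - psi s : R^o) a <= psi a - psi s.
  by rewrite [X in X <= _](deriveN (der _)) De; lra.
apply: derive_le_secant derN _ => t t0 t1.
have := @convex_on_segment R R^o `[0, eta]%classic (fun s : R^o => - psi s) s a t cpsi.
rewrite /= !in_itv /= s0eta (ltW a0) (ltW aeta) => /(_ isT isT t0 t1).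
rewrite /GRing.scale/=.
have -> : t * (s - a) + a = t * s + (1 - t) * a by ring.
lra.
Qed.

(** [psi] is not assumed monotone. A positive slope at [a] gives [psi s <= psi a] through the
    tangent, and by concavity [psi] at a point between [s] and [a] is at least the smaller of the
    two values. *)
Lemma desingularizing_le (a s t : R) :
  0 < a < eta -> 0 < psi^`()%classic a -> 0 <= s -> s <= t -> t <= a ->
  psi s <= psi t.
Proof.
move=> /andP[a0 aeta] psi'a s0 st ta.
have [->//|sneqt] := eqVneq s t.
have [->|tneqa] := eqVneq t a.
  have := @desingularizing_tangent a s; rewrite a0 aeta s0 (le_trans st)//=; last first.
    exact: (le_trans ta (ltW aeta)).
  move=> /(_ isT isT)/le_trans; apply.
  by rewrite gerDl mulr_ge0_le0 ?(ltW psi'a)// subr_le0 (le_trans st).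
have lst : s < t by rewrite lt_neqAle sneqt.
have lta : t < a by rewrite lt_neqAle tneqa.
have psi_sa : psi s <= psi a.
  have := @desingularizing_tangent a s; rewrite a0 aeta s0 (le_trans st)//=; last first.
    exact: (le_trans ta (ltW aeta)).
  move=> /(_ isT isT)/le_trans; apply.
  by rewrite gerDl mulr_ge0_le0 ?(ltW psi'a)// subr_le0 (le_trans st).
case: psi_desing => _ _ cpsi _.
pose l := (a - t) / (a - s).
have as0 : 0 < a - s by rewrite subr_gt0 (lt_trans lst).
have := @convex_on_segment R R^o `[0, eta]%classic (fun s : R^o => - psi s) s a l cpsi.
rewrite /= !in_itv /= s0 (ltW a0) (ltW aeta) (le_trans st) ?(le_trans ta) ?(ltW aeta)//.
have l0 : 0 < l by rewrite divr_gt0// subr_gt0.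
have l1 : l < 1 by rewrite ltr_pdivrMr// mul1r; lra.
move=> /(_ isT isT l0 l1).
rewrite /GRing.scale/=.
have -> : l * s + (1 - l) * a = t by rewrite /l; field; rewrite gt_eqF.
nra.
Qed.

End Desingularizing.

(** The sublevel sets of [F] in [K] at attained values are nested and nonempty, so they generate a
    proper filter; by semicontinuity any cluster point of it is a minimiser. *)
Lemma lsc_attains_min (R : realType) (T : topologicalType) (K : set T)
    (F : T -> R) : compact K -> K !=set0 ->
  (forall x, K x -> forall a, a < F x ->
     \forall y \near x, K y -> a < F y) ->
  exists2 x, K x & forall y, K y -> F x <= F y.
Proof.
move=> cK [k0 Kk0] lscF.
pose B y := K `&` [set x | F x <= F y].
have FB : ProperFilter (filter_from K B).
  apply: filter_from_proper; last by move=> y Ky; exists y; split => /=.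
  apply: filter_from_filter; first by exists k0.
  move=> i j Ki Kj; have [ij|ji] := leP (F i) (F j).
    by exists i => // y [Ky /= yi]; split; split => //=; exact: le_trans ij.
  by exists j => // y [Ky /= yi]; split; split => //=; exact: le_trans (ltW ji).
have [|x [Kx clx]] := cK _ FB; first by exists k0 => // y [].
exists x => // y Ky; rewrite leNgt; apply/negP => lt_yx.
have [||z [[Kz /= zy] /(_ Kz)]] := clx (B y) [set z | K z -> F y < F z].
- by exists y.
- exact: lscF.
by rewrite ltNge zy.
Qed.

(** * Euclidean inner product, norm, balls and distance to a set *)

Section Euclidean.
Context {R : realType} {n : nat}.
Implicit Types (x y z : 'rV[R]_n) (A : set 'rV[R]_n).

Lemma dotvC x y : dotv x y = dotv y x.
Proof. by apply: eq_bigr => i _; rewrite mulrC. Qed.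

Lemma dotvDr x y z : dotv x (y + z) = dotv x y + dotv x z.
Proof. by rewrite -big_split; apply: eq_bigr => i _; rewrite mxE mulrDr. Qed.

Lemma dotvZr x (c : R) y : dotv x (c *: y) = c * dotv x y.
Proof. by rewrite mulr_sumr; apply: eq_bigr => i _; rewrite mxE mulrCA. Qed.

Lemma dotvDl x y z : dotv (x + y) z = dotv x z + dotv y z.
Proof. by rewrite dotvC dotvDr !(dotvC z). Qed.

Lemma dotvZl (c : R) x y : dotv (c *: x) y = c * dotv x y.
Proof. by rewrite dotvC dotvZr dotvC. Qed.

Lemma dotvNr x y : dotv x (- y) = - dotv x y.
Proof. by rewrite -scaleN1r dotvZr mulN1r. Qed.

Lemma dotvNl x y : dotv (- x) y = - dotv x y.
Proof. by rewrite dotvC dotvNr dotvC. Qed.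

Lemma dotvBr x y z : dotv x (y - z) = dotv x y - dotv x z.
Proof. by rewrite dotvDr dotvNr. Qed.

Lemma dotvBl x y z : dotv (x - y) z = dotv x z - dotv y z.
Proof. by rewrite dotvDl dotvNl. Qed.

Lemma dotvv_ge0 x : 0 <= dotv x x.
Proof. by apply: sumr_ge0 => i _; rewrite -expr2 sqr_ge0. Qed.

Lemma sqr_enorm x : enorm x ^+ 2 = dotv x x.
Proof. by rewrite sqr_sqrtr// dotvv_ge0. Qed.

Lemma enorm_ge0 x : 0 <= enorm x.
Proof. exact: sqrtr_ge0. Qed.

Lemma enorm0_eq0 x : enorm x = 0 -> x = 0.
Proof.
move=> x0; have /eqP : dotv x x = 0 by rewrite -sqr_enorm x0 expr0n.
rewrite psumr_eq0; last by move=> i _; rewrite -expr2 sqr_ge0.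
move=> /allP xi0; apply/rowP => i; rewrite mxE.
by have := xi0 i (mem_index_enum _); rewrite mulf_eq0 orbb => /eqP.
Qed.

Lemma enorm0 : enorm (0 : 'rV[R]_n) = 0.
Proof. by rewrite /enorm -(scale0r 0) dotvZl mul0r sqrtr0. Qed.

Lemma enormZ (c : R) x : enorm (c *: x) = `|c| * enorm x.
Proof.
by rewrite /enorm dotvZl dotvZr mulrA -expr2 sqrtrM ?sqr_ge0// sqrtr_sqr.
Qed.

Lemma enormN x : enorm (- x) = enorm x.
Proof. by rewrite -scaleN1r enormZ normrN1 mul1r. Qed.

Lemma enormB x y : enorm (x - y) = enorm (y - x).
Proof. by rewrite -enormN opprB. Qed.

Lemma dotv_le_enorm x y : dotv x y <= enorm x * enorm y.
Proof.
have [/enorm0_eq0 ->|x0] := eqVneq (enorm x) 0.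
  by rewrite enorm0 mul0r -(scale0r 0) dotvZl mul0r.
have [/enorm0_eq0 ->|y0] := eqVneq (enorm y) 0.
  by rewrite enorm0 mulr0 -(scale0r 0) dotvZr mul0r.
have xy : 0 < enorm x * enorm y.
  by rewrite mulr_gt0// lt_neqAle eq_sym ?x0 ?y0 enorm_ge0.
(* Cauchy-Schwarz by expanding the square of this vector, then dividing by [enorm x * enorm y]. *)
have := dotvv_ge0 (enorm y *: x - enorm x *: y).
rewrite dotvBl !dotvBr !dotvZl !dotvZr -!sqr_enorm (dotvC y x) => ge0.
rewrite -(ler_pM2l xy); lra.
Qed.

Lemma norm_dotv_le_enorm x y : `|dotv x y| <= enorm x * enorm y.
Proof.
by rewrite ler_norml dotv_le_enorm andbT lerNl -dotvNl -(enormN x) dotv_le_enorm.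
Qed.

Lemma enormD x y : enorm (x + y) <= enorm x + enorm y.
Proof.
rewrite -(@ler_pXn2r _ 2) ?nnegrE ?addr_ge0 ?enorm_ge0//.
rewrite sqr_enorm sqrrD !sqr_enorm dotvDl !dotvDr (dotvC y x).
have := dotv_le_enorm x y; lra.
Qed.

Lemma cvg_dotv {T : Type} {G : set_system T} {FG : Filter G}
    {u w : T -> 'rV[R]_n} {x y} :
  u @ G --> x -> w @ G --> y ->
  dotv (u t) (w t) @[t --> G] --> dotv x y.
Proof.
move=> ux wy; rewrite /dotv; apply: cvg_big => [|i _]; [exact: add_continuous|apply: cvgM].
  exact: (continuous_cvg _ (@coord_continuous _ _ _ ord0 i x) ux).
exact: (continuous_cvg _ (@coord_continuous _ _ _ ord0 i y) wy).
Qed.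

Lemma cvg_enorm {T : Type} {G : set_system T} {FG : Filter G}
    {u : T -> 'rV[R]_n} {x} :
  u @ G --> x -> enorm (u t) @[t --> G] --> enorm x.
Proof.
move=> ux.
apply: (@continuous_cvg _ _ _ _ _ (fun t => dotv (u t) (u t)) Num.sqrt).
  exact: sqrt_continuous.
exact: cvg_dotv.
Qed.

Lemma cvg_enormB (x y : 'rV[R]_n) : enorm (z - y) @[z --> x] --> enorm (x - y).
Proof.
apply: (@cvg_enorm _ (nbhs x) _ (fun z => z - y)).
exact: (@cvgB R _ _ (nbhs x) _ id (cst y) _ _ cvg_id (cvg_cst y)).
Qed.

Lemma nbhs_eball x (r : R) y : eball x r y -> nbhs y (eball x r).
Proof. by move=> xry; exact: (cvgr_lt _ (cvg_enormB y x)). Qed.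

Lemma enorm_coord x (i : 'I_n) : `|x ord0 i| <= enorm x.
Proof.
rewrite -sqrtr_sqr ler_wsqrtr// /dotv (bigD1 i)//= -expr2 lerDl.
by apply: sumr_ge0 => j _; rewrite -expr2 sqr_ge0.
Qed.

Lemma norm_le_enorm x : `|x| <= enorm x.
Proof.
have [->|x0] := eqVneq x 0; first by rewrite normr0 enorm_ge0.
suff : mx_norm x <= enorm x by [].
have [|[i j] ->] := @mx_norm_neq0 _ _ _ x.
  by apply: contra_neq x0; exact: mx_norm_eq0.
by rewrite ord1 enorm_coord.
Qed.

Lemma compact_eclosed_ball x (r : R) : compact (eclosed_ball x r).
Proof.
apply: bounded_closed_compact.
  exists (r + enorm x); split; first exact: num_real.
  move=> M rM y /= yx; apply: le_trans (norm_le_enorm y) _.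
  rewrite -[y](subrK x); apply: le_trans (enormD _ _) _.
  by apply: ltW (le_lt_trans _ rM); rewrite lerD2r.
apply: (@closed_comp _ _ (fun z => enorm (z - x)) [set s | s <= r]).
  by move=> y _; exact: cvg_enormB.
exact: closed_le.
Qed.

Lemma set_dist_ge0 x A : (0 <= set_dist x A)%E.
Proof. by apply: le_ereal_inf_tmp => _ [y _ <-]; rewrite lee_fin enorm_ge0. Qed.

Lemma set_dist_le x A y : A y -> (set_dist x A <= (enorm (x - y))%:E)%E.
Proof. by move=> Ay; apply: ereal_inf_lbound; exists y. Qed.

End Euclidean.

(** * Error bounds from the KL inequality *)

Section ErrorBound.
Context {R : realType}.

(* Only lower semicontinuity survives: a desingularizing [psi] may jump at [0]. *)
Lemma desingularizing_clamp_lsc (eta : R) (psi : R -> R) (T : topologicalType)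
    (phi : T -> R) (x : T) (a : R) :
  desingularizing eta psi -> 0 < a < eta -> 0 < psi^`()%classic a ->
  (forall b, b < phi x -> \forall y \near x, b < phi y) ->
  forall b, b < psi (Num.max 0 (Num.min (phi x) a)) ->
  \forall y \near x, b < psi (Num.max 0 (Num.min (phi y) a)).
Proof.
move=> psiD /andP[a0 aeta] psi'a lscx b.
have clamp_le s : Num.max 0 (Num.min s a) <= a.
  by rewrite ge_max (ltW a0) ge_min lexx orbT.
(* Here the clamped value at [x] is 0, where [psi] attains its minimum 0. *)
have [phix0|phix0] := leP (phi x) 0.
  rewrite max_l ?ge_min ?phix0//.
  have [-> psi_ge0 _ _] := psiD => b0.
  apply: filterE => y; apply: lt_le_trans b0 _; apply: psi_ge0.
  by rewrite le_max lexx/= (le_trans (clamp_le _))// ltW.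
have c0 : 0 < Num.min (phi x) a by rewrite lt_min phix0.
rewrite max_r ?ltW//; set c := Num.min _ _ in c0 * => bc.
have ca : c <= a by rewrite ge_min lexx orbT.
have /differentiable_continuous/cvgr_gt/(_ _ bc) :
    differentiable (psi : R^o -> R^o) c.
  have [_ _ _ /(_ c)[]//] := psiD.
  by rewrite /= in_itv /= c0 (le_lt_trans ca).
move=> /nbhs_ballP[e /= e0 nearc].
(* [c - m / 2] lies in []0, c[] and still has [psi] above [b]; monotonicity up to [a] passes this on
   to every larger clamped value. *)
pose m := Num.min e c.
have m0 : 0 < m by rewrite lt_min e0.
have me : m <= e by rewrite ge_min lexx.
have mc : m <= c by rewrite ge_min lexx orbT.
have bpsi : b < psi (c - m / 2).
  apply: nearc; rewrite /ball /= opprB addrC subrK gtr0_norm; lra.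
have : c - m / 2 < phi x.
  by apply: (@lt_le_trans _ _ c); [lra|rewrite ge_min lexx].
move=> /lscx; apply: filterS => y ylt; apply: lt_le_trans bpsi _.
apply: (@desingularizing_le R eta psi psiD a); rewrite ?a0//.
- lra.
- by rewrite le_max le_min (ltW ylt)/= orbC; apply/orP; left; lra.
Qed.

Context {n : nat}.
Implicit Types (x y z u : 'rV[R]_n).

(* Differentiable everywhere, with gradient of norm at most [1]. *)
Definition softdist x (d : R) u : R := Num.sqrt (dotv (u - x) (u - x) + d ^+ 2).

Lemma softdist_gt0 x (d : R) u : 0 < d -> 0 < softdist x d u.
Proof. by move=> d0; rewrite sqrtr_gt0 ltr_wpDl ?dotvv_ge0 ?exprn_gt0. Qed.

Lemma softdist_center x (d : R) : 0 < d -> softdist x d x = d.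
Proof.
by move=> d0; rewrite /softdist subrr -sqr_enorm enorm0 expr0n add0r sqrtr_sqr gtr0_norm.
Qed.

Lemma enorm_le_softdist x (d : R) u : enorm (u - x) <= softdist x d u.
Proof. by rewrite ler_wsqrtr// lerDl sqr_ge0. Qed.

Lemma softdist_le_center x (d : R) u : 0 < d -> softdist x d u <= d -> u = x.
Proof.
move=> d0; rewrite -{2}(gtr0_norm d0) -sqrtr_sqr ler_sqrt ?sqr_ge0//.
rewrite gerDr -sqr_enorm => le0; apply/eqP; rewrite -subr_eq0; apply/eqP.
by apply: enorm0_eq0; apply/eqP; rewrite -sqrf_eq0 eq_le le0 sqr_ge0.
Qed.

(** A first-order model with quadratic error: [S Z <= (S^2 + Z^2) / 2], while [Z^2] expands exactly
    around [u]. *)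
Lemma softdist_le_quadratic x (d : R) u z : 0 < d ->
  softdist x d z <= softdist x d u + dotv (u - x) (z - u) / softdist x d u
                    + enorm (z - u) ^+ 2 / (2 * softdist x d u).
Proof.
move=> d0; have := softdist_gt0 x d u d0; have := softdist_gt0 x d z d0.
set S := softdist x d u; set Z := softdist x d z => Z0 S0.
have S2 : S ^+ 2 = dotv (u - x) (u - x) + d ^+ 2.
  by rewrite sqr_sqrtr// addr_ge0 ?dotvv_ge0 ?sqr_ge0.
have Z2 : Z ^+ 2 = dotv (z - x) (z - x) + d ^+ 2.
  by rewrite sqr_sqrtr// addr_ge0 ?dotvv_ge0 ?sqr_ge0.
have ZS : Z ^+ 2 = S ^+ 2 + 2 * dotv (u - x) (z - u) + enorm (z - u) ^+ 2.
  rewrite Z2 S2 sqr_enorm; have -> : z - x = (u - x) + (z - u).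
    by rewrite [RHS]addrC addrA subrK.
  move: (u - x) (z - u) => p q.
  by rewrite dotvDl !dotvDr (dotvC q p); ring.
rewrite -(ler_pM2l S0); have -> : S * (S + dotv (u - x) (z - u) / S
    + enorm (z - u) ^+ 2 / (2 * S)) = (S ^+ 2 + Z ^+ 2) / 2.
  by rewrite ZS; field; rewrite gt_eqF.
by have := sqr_ge0 (S - Z); lra.
Qed.

Lemma cvg_softdist x (d : R) u : softdist x d z @[z --> u] --> softdist x d u.
Proof.
have cB : (fun z => z - x) @ u --> u - x.
  exact: (@cvgB R _ _ (nbhs u) _ id (cst x) _ _ cvg_id (cvg_cst x)).
have cS : dotv (z - x) (z - x) + d ^+ 2 @[z --> u] --> dotv (u - x) (u - x) + d ^+ 2.
  exact: (@cvgD R R _ (nbhs u) _ _ (cst (d ^+ 2)) _ _ (cvg_dotv cB cB) (cvg_cst _)).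
exact: (continuous_cvg _ (@sqrt_continuous R _) cS).
Qed.

End ErrorBound.

(** * From the KL inequality to the error bound *)

Section KL.
Context {R : realType} {n : nat}.
Implicit Types (x y z u : 'rV[R]_n).

(** For [p <= 0] the product is at most 0, even when the subdifferential is empty and the distance
    is [+oo]. *)
Lemma KL_slope_gt0 (F : 'rV[R]_n -> \bar R) (u : 'rV[R]_n) (p : R) :
  (1 <= p%:E * set_dist 0 (limiting_subdiff F u))%E -> 0 < p.
Proof.
move=> slope; rewrite ltNge; apply/negP => p0.
have : (p%:E * set_dist 0%R (limiting_subdiff F u) <= 0)%E.
  by apply: mule_le0_ge0; rewrite ?lee_fin// set_dist_ge0.
by move=> /(le_trans slope); rewrite lee_fin ler10.
Qed.

(** A regular subgradient is a limiting one, by constant sequences, so its norm bounds the distance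
    from above. *)
Lemma KL_slope_ge (F : 'rV[R]_n -> \bar R) (u v : 'rV[R]_n) (p : R) :
  (1 <= p%:E * set_dist 0 (limiting_subdiff F u))%E ->
  regular_subdiff F u v -> 1 <= p * enorm v.
Proof.
move=> slope vF; have p0 := KL_slope_gt0 _ _ _ slope.
have vlim : limiting_subdiff F u v.
  have [Fu _] := vF; split => //; exists (fun=> u), (fun=> v).
  by split => //; exact: cvg_cst.
rewrite -lee_fin; apply: le_trans slope _.
rewrite EFinM lee_wpmul2l ?lee_fin ?(ltW p0)//.
by apply: le_trans (set_dist_le 0 _ _ vlim) _; rewrite sub0r enormN.
Qed.

Lemma KL_error_bound (F : 'rV[R]_n -> \bar R) (xs : 'rV[R]_n) (psi : R -> R)
    (rho : R) :
  0 < rho ->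
  (forall u, eball xs rho u -> F u \is a fin_num) ->
  (forall u a, eball xs rho u -> (a%:E < F u)%E ->
     \forall z \near u, (a%:E < F z)%E) ->
  KL_property F xs psi ->
  exists eps eta : R, [/\ 0 < eps, 0 < eta &
    forall x, eball xs eps x ->
      (F xs < F x)%E -> (F x < F xs + eta%:E)%E ->
      (set_dist x (sublevel F (F xs)) <= (psi (fine (F x - F xs)%E))%:E)%E].
Proof.
move=> rho0 finF lscF [_ [eta [eta0 psiD [e e0 KL]]]].
pose r := Num.min rho e.
have r0 : 0 < r by rewrite lt_min rho0.
(* Half of [r]: the ball searched below is centred at [x] with radius at most [enorm (x - xs)], so
   it stays within [r] of [xs]. *)
exists (r / 2), eta; split=> //; first by rewrite divr_gt0.
move=> x xxs Fx Fxeta; rewrite leNgt; apply/negP => psi_lt.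
have xs_ball : eball xs rho xs by rewrite /eball /= subrr enorm0.
pose phi u := fine (F u) - fine (F xs).
have FE u : eball xs rho u -> F u = (phi u + fine (F xs))%:E.
  by move=> /finF Fu; rewrite subrK fineK.
have FxsE : F xs = (fine (F xs))%:E by rewrite fineK ?finF.
have r_rho : r <= rho by rewrite ge_min lexx.
have r_e : r <= e by rewrite ge_min lexx orbT.
have rball u : eball xs r u -> eball xs rho u /\ eball xs e u.
  by move=> xu; split; apply: lt_le_trans xu _.
have x_rball : eball xs r x by apply: lt_le_trans xxs _; lra.
have [x_rho x_e] := rball _ x_rball.
have phi_gt0 u : eball xs rho u -> (F xs < F u)%E = (0 < phi u).
  by move=> /FE ->; rewrite FxsE lte_fin ltrDr.
have KLphi u : eball xs r u -> 0 < phi u -> phi u < eta ->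
    (1 <= (psi^`()%classic (phi u))%:E * set_dist 0 (limiting_subdiff F u))%E.
  move=> xru u0 ueta; have [u_rho u_e] := rball _ xru.
  have -> : phi u = fine (F u - F xs)%E by rewrite fineB// finF.
  apply: KL => //; first by rewrite phi_gt0.
  by rewrite (FE u)// {2}FxsE -EFinD lte_fin addrC ltrD2l.
pose a := phi x.
have a0 : 0 < a by rewrite -phi_gt0.
have aeta : a < eta.
  by move: Fxeta; rewrite (FE x)// {2}FxsE -EFinD lte_fin addrC ltrD2l.
have psi'a : 0 < psi^`()%classic a by exact: KL_slope_gt0 (KLphi _ _ _ _).
have psi_ge0 : 0 <= psi a by have [_ + _ _] := psiD; apply; rewrite !ltW.
have distx : (set_dist x (sublevel F (F xs)) <= (enorm (x - xs))%:E)%E.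
  by apply: set_dist_le; rewrite /sublevel /=.
have dist_fin : set_dist x (sublevel F (F xs)) \is a fin_num.
  by rewrite ge0_fin_numE ?set_dist_ge0// (le_lt_trans distx)// ltry.
pose d := fine (set_dist x (sublevel F (F xs))).
have dE : set_dist x (sublevel F (F xs)) = d%:E by rewrite fineK.
have psi_d : psi a < d.
  by move: psi_lt; rewrite dE lte_fin; congr (psi _ < _); rewrite fineB// finF.
have d_le : d < r / 2 by move: distx; rewrite dE lee_fin => /le_lt_trans; apply.
have d_lb u : (F u <= F xs)%E -> d <= enorm (x - u).
  by move=> Fu; rewrite -lee_fin -dE; exact: set_dist_le.
have d0 : 0 < d by exact: le_lt_trans psi_d.
(* [lam * d] is taken midway between [psi a] and [d]. *)
have [lam [lam0 lam1 lamd]] : exists lam, [/\ 0 < lam, lam < 1 & psi a < lam * d].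
  exists ((psi a + d) / (2 * d)); split.
  - by rewrite divr_gt0; lra.
  - by rewrite ltr_pdivrMr; lra.
  - have -> : (psi a + d) / (2 * d) * d = (psi a + d) / 2.
      by field; rewrite gt_eqF.
    lra.
(* The smoothing width [dl] uses up half of the gap [lam * d - psi a], so that [G x] stays below
   [lam * d]. *)
have [dl dl0 lamdl] : exists2 dl, 0 < dl & psi a + lam * dl < lam * d.
  exists ((lam * d - psi a) / (2 * lam)).
    by rewrite divr_gt0 ?mulr_gt0// subr_gt0.
  have -> : lam * ((lam * d - psi a) / (2 * lam)) = (lam * d - psi a) / 2.
    by field; rewrite gt_eqF.
  lra.
(* Clamping [phi] to [[0, a]] keeps the argument of [psi] where [psi] is monotone, which makes [G]
   lower semicontinuous. *)
pose G u := psi (Num.max 0 (Num.min (phi u) a)) + lam * softdist x dl u.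
have ball_d u : eclosed_ball x d u -> eball xs r u.
  rewrite /eclosed_ball /eball /= in xxs * => xdu; have -> : u - xs = (u - x) + (x - xs).
    by rewrite addrA subrK.
  by apply: le_lt_trans (enormD _ _) _; lra.
have phi_lsc u : eball xs rho u -> forall b, b < phi u ->
    \forall y \near u, b < phi y.
  move=> u_rho b bu.
  have : ((b + fine (F xs))%:E < F u)%E by rewrite (FE u)// lte_fin ltrD2r.
  move=> /(lscF _ _ u_rho); apply: filter_app.
  have := nbhs_eball _ _ _ u_rho.
  by apply: filterS => y /FE ->; rewrite lte_fin ltrD2r.
have [||u xdu Gmin] := lsc_attains_min R _ (eclosed_ball x d) G
    (compact_eclosed_ball _ _).
- by exists x; rewrite /eclosed_ball /= subrr enorm0 ltW.
- move=> u xdu b bG.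
  have u_rho := (rball _ (ball_d _ xdu)).1.
  (* Half of the gap for each of the two terms of [G]. *)
  pose m := (G u - b) / 2.
  have m0 : 0 < m by rewrite divr_gt0// subr_gt0.
  have := desingularizing_clamp_lsc eta psi _ phi u a psiD _ psi'a (phi_lsc _ u_rho).
  rewrite a0 aeta => /(_ isT (psi (Num.max 0 (Num.min (phi u) a)) - m)).
  rewrite gtrBl => /(_ m0); apply: filter_app.
  have := cvg_softdist x dl u => /cvgr_gt/(_ (softdist x dl u - m / lam)).
  rewrite gtrBl divr_gt0// => /(_ isT); apply: filterS => y.
  rewrite ltrBlDr -ltrBlDl -(ltr_pM2l lam0) mulrBr [lam * (m / _)]mulrC divfK ?gt_eqF//.
  move=> ylam ypsi _; rewrite /G.
  have bE : b = G u - 2 * m by rewrite /m; field.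
  rewrite bE {1}/G; lra.
have Gu_le : G u <= psi a + lam * dl.
  have := Gmin x; rewrite {2}/G softdist_center// minxx max_r ?(ltW a0)//.
  by apply; rewrite /eclosed_ball /= subrr enorm0 ltW.
have clamp_ge0 (s : R) : 0 <= Num.max 0 (Num.min s a) <= eta.
  rewrite le_max lexx/= ge_max (ltW eta0)/= ge_min; apply/orP; right; exact: ltW.
(* As [psi >= 0], [lam * enorm (u - x) <= G u <= G x < lam * d]: the minimiser is interior. *)
have xdu_lt : enorm (u - x) < d.
  rewrite -(ltr_pM2l lam0).
  have : lam * enorm (u - x) <= G u.
    rewrite /G ler_wpDl ?ler_pM2l ?enorm_le_softdist//.
    by have [_ + _ _] := psiD; apply.
  lra.
have u_r := ball_d _ xdu.
have [u_rho _] := rball _ u_r.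
have u0 : 0 < phi u.
  rewrite -phi_gt0// ltNge; apply/negP => /d_lb.
  by rewrite enormB leNgt xdu_lt.
(* Otherwise the first term of [G u] is already [psi a], and [G u <= G x] forces [u] to be the
   centre [x], where [phi] equals [a]. *)
have ua : phi u <= a.
  rewrite leNgt; apply/negP => au.
  have ux : u = x.
    apply: (softdist_le_center x dl) => //.
    move: Gu_le; rewrite /G min_r ?(ltW au)// max_r ?(ltW a0)//.
    by rewrite lerD2l ler_pM2l.
  by move: au; rewrite ux ltxx.
pose p := psi^`()%classic (phi u).
have slope := KLphi _ u_r u0 (le_lt_trans ua aeta).
have p0 : 0 < p by exact: KL_slope_gt0 slope.
pose S := softdist x dl u.
have S0 : 0 < S by exact: softdist_gt0.
(* The vector solving the formal optimality condition [p v + lam (u - x) / S = 0], where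
   [(u - x) / S] is the gradient of [softdist x dl] at [u]. *)
pose v := - (lam / (p * S)) *: (u - x).
suff : regular_subdiff F u v.
  move=> /(KL_slope_ge _ _ _ _ slope); rewrite enormZ normrN gtr0_norm ?divr_gt0 ?mulr_gt0//.
  rewrite -/p leNgt => /negP; apply.
  have -> : p * (lam / (p * S) * enorm (u - x)) = lam * (enorm (u - x) / S).
    by field; rewrite !gt_eqF.
  apply: le_lt_trans lam1; rewrite -[leRHS]mulr1 ler_pM2l// ler_pdivrMr// mul1r.
  exact: enorm_le_softdist.
split; first exact: finF.
move=> b b0.
(* The last radius makes the quadratic remainder [lam |z - u|^2 / (2 S)] at most [b p |z - u|]. *)
have near_u : \forall z \near u, [/\ 0 < phi z, eball x d z &
    enorm (z - u) < b * (2 * S * p) / lam].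
  have [] : [/\ \forall z \near u, 0 < phi z, \forall z \near u, eball x d z &
      \forall z \near u, enorm (z - u) < b * (2 * S * p) / lam].
    split; [exact: phi_lsc|exact: nbhs_eball|].
    by apply: nbhs_eball; rewrite /eball /= subrr enorm0 divr_gt0 ?mulr_gt0.
  by move=> n1 n2 n3; near=> z; split; near: z.
apply: filterS near_u => z [z0 xdz zu].
have z_rho : eball xs rho z by apply: (rball _ (ball_d _ _)).1; exact: ltW.
rewrite (FE u)// (FE z)// -EFinD lee_fin.
suff : dotv v (z - u) - b * enorm (z - u) <= phi z - phi u by lra.
have := Gmin z (ltW xdz); rewrite /G !max_r ?le_min ?(ltW z0) ?(ltW u0) ?(ltW a0)//.
rewrite [Num.min (phi u) a]min_l// -/S.
(* Since [p > 0], replacing [s] by the larger [phi z] in the tangent bound keeps it valid. *)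
set s := Num.min (phi z) a => Guz.
have s_phi : p * s <= p * phi z by rewrite ler_pM2l// ge_min lexx.
have s0eta : 0 <= s <= eta.
  by rewrite le_min (ltW z0) (ltW a0) ge_min (ltW aeta) orbT.
have := desingularizing_tangent eta psi psiD (phi u) s.
rewrite u0 (le_lt_trans ua aeta) s0eta -/p => /(_ isT isT) tangent.
have := softdist_le_quadratic x dl u z dl0; rewrite -/S -(ler_pM2l lam0) => quad.
move: zu; rewrite ltr_pdivlMr// => zu.
have D0 := enorm_ge0 (z - u).
have bound : lam * (enorm (z - u) ^+ 2 / (2 * S)) <= b * p * enorm (z - u).
  rewrite mulrA ler_pdivrMr ?mulr_gt0//.
  have := ler_wpM2r D0 (ltW zu); lra.
rewrite -(ler_pM2l p0) /v dotvZl.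
have -> : p * (- (lam / (p * S)) * dotv (u - x) (z - u) - b * enorm (z - u)) =
    - (lam * (dotv (u - x) (z - u) / S)) - b * p * enorm (z - u).
  by field; rewrite !gt_eqF.
lra.
Unshelve. all: by end_near.
Qed.

End KL.

(** * Relatively smooth functions and the forward-backward envelope *)

Section Segments.
Context {R : realType} {n : nat}.
Implicit Types (x y z v : 'rV[R]_n) (F h f g : 'rV[R]_n -> \bar R).

Lemma cvg_rV {T : Type} {G : set_system T} {FG : Filter G}
    (u : T -> 'rV[R]_n) x :
  (forall i, u t ord0 i @[t --> G] --> x ord0 i) -> u @ G --> x.
Proof.
move=> ux A [P xP PA]; rewrite /nbhs/=.
have : \forall t \near G, forall i, P ord0 i (u t ord0 i).
  by apply: filter_forall => i; exact: (ux i _ (xP ord0 i)).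
by apply: filterS => t Pt; apply: PA => k i; rewrite ord1.
Qed.

Lemma dotv_grad F x v :
  differentiable (fine \o F) x -> dotv (grad F x) v = 'D_v (fine \o F) x.
Proof.
move=> dF; rewrite deriveE// {2}(row_sum_delta v) linear_sum/=.
by apply: eq_bigr => i _; rewrite linearZ/= mxE deriveE// mulrC.
Qed.

Lemma cvg_grad (U : set 'rV[R]_n) F x :
  C1_on U (fine \o F) -> U x -> grad F @ x --> grad F x.
Proof.
move=> C1F Ux; apply: (@cvg_rV _ (nbhs x) _ (grad F)) => i.
have [_ /(_ (delta_mx ord0 i)) cF] := C1F x Ux.
rewrite mxE; under eq_fun do rewrite mxE.
exact: cF.
Qed.

Lemma segmentE x z (t : R) : t *: z + (1 - t) *: x = t *: (z - x) + x.
Proof. by apply/rowP => i; rewrite !mxE; ring. Qed.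

Lemma near_segment_end x z (B : set 'rV[R]_n) : nbhs z B ->
  \forall t \near (1 : R)^'-, [/\ 0 < t, t < 1 & B (t *: z + (1 - t) *: x)].
Proof.
move=> Bz.
have c1 : (t *: (z - x) + x) @[t --> (1 : R)] --> (1 : R) *: (z - x) + x.
  apply: (@cvgD R _ _ (nbhs (1 : R)) _ _ (cst x)); last exact: cvg_cst.
  exact: (@cvgZr_tmp R _ _ (nbhs (1 : R)) _ id 1 (z - x) cvg_id).
rewrite scale1r subrK in c1.
have n1 : \forall t \near (1 : R), B (t *: z + (1 - t) *: x).
  by near=> t; rewrite segmentE; near: t; exact: (c1 _ Bz).
near=> t; split.
- near: t; exact: nbhs_left_gt.
- near: t; exact: nbhs_left_lt.
- near: t; exact: cvg_at_left_filter n1.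
Unshelve. all: by end_near.
Qed.

(** The affine map [q] sends [y] to [x], hence points near [y] into [dom h]; each such [w] is a
    convex combination of [z] and [q w]. *)
Lemma interior_dom_segment h x z (t : R) : econvex h ->
  (dom h)° x -> dom h z -> 0 < t -> t < 1 ->
  (dom h)° (t *: z + (1 - t) *: x).
Proof.
move=> hconv xC zh t0 t1; set y := t *: z + _.
have t1' : 1 - t != 0 by rewrite subr_eq0 gt_eqF.
pose q w := (1 - t)^-1 *: (w - t *: z).
have qy : q @ y --> x.
  have -> : x = q y by rewrite /q /y addrAC subrr add0r scalerA mulVf// scale1r.
  have cB : (fun w => w - t *: z) @ y --> y - t *: z.
    exact: (@cvgB R _ _ (nbhs y) _ id (cst (t *: z)) _ _ cvg_id (cvg_cst _)).
  exact: (cvgZl_tmp cB).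
suff : \forall w \near y, dom h w by [].
near=> w; have qw : dom h (q w) by near: w; exact: (qy _ xC).
have -> : w = t *: z + (1 - t) *: q w.
  by rewrite /q scalerA mulfV// scale1r addrC subrK.
apply: le_lt_trans (hconv _ _ _ t0 t1) _.
by rewrite lte_add_pinfty// lte_mul_pinfty ?lee_fin ?subr_ge0 ?ltW.
Unshelve. all: by end_near.
Qed.

End Segments.

(** * Bregman distance and the descent inequality *)

Section Descent.
Context {R : realType} {n : nat}.
Implicit Types (x y z : 'rV[R]_n) (F h f g : 'rV[R]_n -> \bar R).

(** Real-valued form of [bregman h z x], faithful for [x] interior to [dom h] and [h z] finite. *)
Definition bregmanr h z x : R :=
  fine (h z) - fine (h x) - dotv (grad h x) (z - x).

Lemma proper_fun_fin_num F x : proper_fun F -> dom F x -> F x \is a fin_num.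
Proof.
by move=> [FNy _] Fx; rewrite fin_numE FNy lt_eqF.
Qed.

Lemma bregmanr_ge0 h x z : legendre_kernel h -> (dom h)° x -> dom h z ->
  0 <= bregmanr h z x.
Proof.
move=> hL xC zh; have [hprop _ hconv _ hC1 _ _ _] := hL.
have xh : dom h x by exact: interior_subset.
have [dh _] := hC1 x xC.
rewrite subr_ge0 dotv_grad//; apply: derive_le_secant; first exact: diff_derivable.
move=> t t0 t1; rewrite -segmentE /=.
have := hconv z x t t0 t1.
have th : dom h (t *: z + (1 - t) *: x).
  by apply: interior_subset; exact: interior_dom_segment.
rewrite -(fineK (proper_fun_fin_num _ _ hprop zh)) -(fineK (proper_fun_fin_num _ _ hprop xh)).
rewrite -(fineK (proper_fun_fin_num _ _ hprop th)) -!EFinM -EFinD lee_fin; lra.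
Qed.

(** For interior [z] this is the gradient inequality of the convex function [L h - f] at [x]. A
    boundary point [z] is approached along the segment from [x], using lower semicontinuity of [f]
    and convexity of [h]. *)
Lemma rel_smooth_descent (L : R) f h x z :
  legendre_kernel h -> rel_smooth L f h -> C1_on (dom h)° (fine \o f) ->
  (dom h)° x -> dom h z ->
  fine (f z) <= fine (f x) + dotv (grad f x) (z - x) + L * bregmanr h z x.
Proof.
move=> hL fh fC1 xC zh; have [hprop _ hconv _ hC1 _ _ _] := hL.
have [L0 fprop flsc hf _ cLhf] := fh.
have [dh _] := hC1 x xC; have [df _] := fC1 x xC.
have descent y : (dom h)° y ->
    fine (f y) <= fine (f x) + dotv (grad f x) (y - x) + L * bregmanr h y x.
  move=> yC; have dLh : derivable (L \*: (fine \o h)) x (y - x).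
    by apply: derivableZ; exact: diff_derivable.
  have df' : derivable (fine \o f) x (y - x) by exact: diff_derivable.
  have dLhf : derivable (L \*: (fine \o h) - (fine \o f)) x (y - x) by exact: derivableB.
  have := derive_le_secant _ _ _ x (y - x)
    (L * fine (h y) - fine (f y) - (L * fine (h x) - fine (f x))) dLhf.
  rewrite deriveB// deriveZ; last exact: diff_derivable.
  rewrite -!dotv_grad// /GRing.scale/= /bregmanr => secant.
  suff : L * dotv (grad h x) (y - x) - dotv (grad f x) (y - x) <=
      L * fine (h y) - fine (f y) - (L * fine (h x) - fine (f x)) by lra.
  apply: secant => t t0 t1; rewrite -segmentE.
  have := convex_on_segment _ _ _ _ y x t cLhf yC xC t0 t1.
  rewrite !fctE /= /GRing.scale/=; lra.
have zf : f z \is a fin_num by apply: proper_fun_fin_num => //; exact: hf.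
set E := dotv (grad f x) (z - x) + L * bregmanr h z x.
rewrite -addrA -/E leNgt; apply/negP => ltE.
(* Midway between the claimed bound and [f z]: near [z], [f] exceeds [a], whereas on the segment it
   is at most [fine (f x) + t * E], which is at most [a] for [t] near 1. *)
pose a := (fine (f x) + E + fine (f z)) / 2.
have az : (a%:E < f z)%E by rewrite -(fineK zf) lte_fin /a; lra.
have [V Vz Va] := flsc _ _ az.
have segment_le : \forall t \near (1 : R)^'-, fine (f x) + t * E <= a.
  suff : \forall t \near (1 : R), fine (f x) + t * E <= a by exact: cvg_at_left_filter.
  have c1 : fine (f x) + t * E @[t --> (1 : R)] --> fine (f x) + 1 * E.
    apply: (@cvgD R R _ (nbhs (1 : R)) _ (cst (fine (f x)))); first exact: cvg_cst.
    exact: (@cvgMr_tmp R _ (nbhs (1 : R)) _ id 1 E cvg_id).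
  by apply: (cvgr_le _ c1); rewrite mul1r /a; lra.
near (1 : R)^'- => t.
have [t0 t1 Vt] : [/\ 0 < t, t < 1 & V (t *: z + (1 - t) *: x)].
  by near: t; exact: near_segment_end.
have ta : fine (f x) + t * E <= a by near: t.
have tC := interior_dom_segment h x z t hconv xC zh t0 t1.
have := Va _ Vt.
have th := interior_subset tC; have xh := interior_subset xC.
rewrite -(fineK (proper_fun_fin_num _ _ fprop (hf _ th))) lte_fin => aft.
have := descent _ tC; have := hconv z x t t0 t1.
rewrite -(fineK (proper_fun_fin_num _ _ hprop zh)) -(fineK (proper_fun_fin_num _ _ hprop xh)).
rewrite -(fineK (proper_fun_fin_num _ _ hprop th)) -!EFinM -EFinD lee_fin => /(ler_wpM2l L0).
rewrite /E /bregmanr in ta *; rewrite segmentE addrK !dotvZr -segmentE in aft *.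
lra.
Unshelve. all: by end_near.
Qed.

(** Lets the minimality of [f + g] over the closure of the interior be applied at every point of
    [dom h]. *)
Lemma segment_closure_interior h x z : econvex h -> (dom h)° x -> dom h z ->
  closure (dom h)° z.
Proof.
move=> hconv xC zh B Bz.
near (1 : R)^'- => t.
have [t0 t1 Bt] : [/\ 0 < t, t < 1 & B (t *: z + (1 - t) *: x)].
  by near: t; exact: near_segment_end.
by exists (t *: z + (1 - t) *: x); split => //; exact: interior_dom_segment.
Unshelve. all: by end_near.
Qed.

End Descent.

(** * The envelope as an infimum of affine perturbations of one function *)

Section Envelope.
Context {R : realType} {n : nat}.
Implicit Types (x y z : 'rV[R]_n) (h f g : 'rV[R]_n -> \bar R).

(** This and [envelope_offset] collect all dependence of the model on [x]: as a function of [z] it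
    is offset plus [dotv] slope [z], plus [g z + h z / gamma]. *)
Definition envelope_slope f h (gamma : R) x : 'rV[R]_n :=
  grad f x - gamma^-1 *: grad h x.

Definition envelope_offset f h (gamma : R) x : R :=
  fine (f x) - dotv (grad f x) x
  - gamma^-1 * (fine (h x) - dotv (grad h x) x).

Lemma cvg_envelope_slope (U : set 'rV[R]_n) f h (gamma : R) x :
  C1_on U (fine \o f) -> C1_on U (fine \o h) -> U x ->
  envelope_slope f h gamma @ x --> envelope_slope f h gamma x.
Proof.
move=> fC1 hC1 Ux; rewrite /envelope_slope.
apply: (@cvgB R _ _ (nbhs x)); first exact: cvg_grad fC1 Ux.
apply: (@cvgZl_tmp _ _ _ (nbhs x)); exact: cvg_grad hC1 Ux.
Qed.

Lemma cvg_envelope_offset (U : set 'rV[R]_n) f h (gamma : R) x :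
  C1_on U (fine \o f) -> C1_on U (fine \o h) -> U x ->
  envelope_offset f h gamma @ x --> envelope_offset f h gamma x.
Proof.
move=> fC1 hC1 Ux.
have cvg_part F : C1_on U (fine \o F) ->
    fine (F t) - dotv (grad F t) t @[t --> x] --> fine (F x) - dotv (grad F x) x.
  move=> FC1; have [dF _] := FC1 x Ux.
  apply: (@cvgB R R _ (nbhs x)); first exact: differentiable_continuous dF.
  apply: (@cvg_dotv _ _ _ (nbhs x)); first exact: cvg_grad FC1 Ux.
  exact: cvg_id.
apply: (@cvgB R R _ (nbhs x)); first exact: (cvg_part f fC1).
apply: (@cvgMl_tmp _ _ (nbhs x)); exact: (cvg_part h hC1).
Qed.

Lemma bfb_modelE f g h (gamma : R) x z :
  0 < gamma -> (dom h)° x -> f x \is a fin_num -> h x \is a fin_num ->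
  g z != -oo%E -> h z != -oo%E ->
  bfb_model f g h gamma x z =
  ((envelope_offset f h gamma x + dotv (envelope_slope f h gamma x) z)%:E
   + (g z + (gamma^-1)%:E * h z))%E.
Proof.
move=> gamma0 xC fx hx; rewrite /bfb_model /bregman asboolT//.
rewrite -{1}(fineK fx) -{1}(fineK hx).
have gammaV : (0 < (gamma^-1)%:E)%E by rewrite lte_fin invr_gt0.
case: (h z) (g z) => [s||] [r||]//= _ _; rewrite ?gt0_muley//.
congr (_%:E).
rewrite /envelope_offset /envelope_slope dotvBl dotvZl !dotvBr; ring.
Qed.

(** By the descent inequality the model is at least [f z + g z + (1 / gamma - L) D], with [D] the
    Bregman distance. The sum [f + g] is bounded below on [dom h], and 1-coercivity of [h] makes [D]
    outgrow any multiple of [enorm z]. *)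
Lemma bfb_model_coercive (L : R) f g h (gamma : R) x :
  legendre_kernel h -> rel_smooth L f h -> C1_on (dom h)° (fine \o f) ->
  proper_fun g ->
  argmin (closure (dom h)°) (fun z => f z + g z)%E !=set0 ->
  0 < gamma -> (gamma%:E < (L%:E)^-1)%E -> (dom h)° x ->
  exists B, forall z, ((enorm z - B)%:E <= bfb_model f g h gamma x z)%E.
Proof.
move=> hL fh fC1 gprop [x0 [_ phix0 phi_min]] gamma0 gammaL xC.
have [hprop _ hconv _ hC1 _ _ hcoer] := hL.
have [L0 fprop _ hf _ _] := fh.
have xh : dom h x := interior_subset xC.
have hx := proper_fun_fin_num _ _ hprop xh.
have fx := proper_fun_fin_num _ _ fprop (hf _ xh).
have phi_fin : (f x0 + g x0)%E \is a fin_num.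
  rewrite fin_numE (lt_eqF phix0) andbT.
  by rewrite adde_eq_ninfty negb_or fprop.1 gprop.1.
pose m := fine (f x0 + g x0)%E.
have m_le z : dom h z -> (m%:E <= f z + g z)%E.
  by move=> zh; rewrite fineK//; apply: phi_min; exact: segment_closure_interior xC zh.
pose c := gamma^-1 - L.
have c0 : 0 < c.
  rewrite subr_gt0; have [->|L_neq0] := eqVneq L 0; first by rewrite invr_gt0.
  have L_gt0 : 0 < L by rewrite lt_neqAle eq_sym L_neq0.
  move: gammaL; rewrite inver (negbTE L_neq0) lte_fin => gammaL.
  by rewrite -[L]invrK ltf_pV2// posrE invr_gt0.
pose b := fine (h x) - dotv (grad h x) x.
(* This slope absorbs the linear term of [D] and leaves [c^-1 * enorm z], which becomes [enorm z]
   after multiplication by [c]. *)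
have [r r0 coer] := hcoer (enorm (grad h x) + c^-1).
exists (`|m| + r + `|c * b|) => z.
have [zh|] := boolP (h z < +oo)%E; last first.
  rewrite -leNgt leye_eq => /eqP hz; rewrite bfb_modelE ?gprop.1 ?hprop.1// hz.
  rewrite gt0_muley ?lte_fin ?invr_gt0//.
  by have := gprop.1 z; case: (g z) => //= *; rewrite leey.
rewrite /bfb_model /bregman asboolT//.
have hz := proper_fun_fin_num _ _ hprop zh.
have fz := proper_fun_fin_num _ _ fprop (hf _ zh).
have := m_le _ zh; have := gprop.1 z.
rewrite -(fineK fz) -(fineK fx) -(fineK hx) -(fineK hz).
case: (g z) => [s||]//= _; last by move=> _; rewrite leey.
rewrite !lee_fin => m_le_phi.
have := rel_smooth_descent _ _ _ _ _ hL fh fC1 xC zh.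
have := bregmanr_ge0 _ _ _ hL xC zh.
rewrite -/(bregmanr h z x); set D := bregmanr h z x => D0 descent.
have cDE : c * D = gamma^-1 * D - L * D by rewrite /c mulrBl.
suff : enorm z - (`|m| + r + `|c * b|) <= m + c * D by lra.
have cD0 : 0 <= c * D by rewrite mulr_ge0// ltW.
have m_ge := ler_norm (- m); rewrite normrN in m_ge.
have cb_ge0 := normr_ge0 (c * b).
have [zr|rz] := leP (enorm z) r; first by lra.
have z0 : 0 < enorm z by exact: lt_trans rz.
have := coer z rz; rewrite -(fineK hz) inver gt_eqF// -EFinM lee_fin.
rewrite ler_pdivlMr// => hz_ge.
have cb := ler_norm (c * b).
have := dotv_le_enorm (grad h x) z => grad_z.
have D_ge : c^-1 * enorm z - b <= D.
  rewrite /D /bregmanr /b dotvBr; lra.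
have := ler_wpM2l (ltW c0) D_ge.
by rewrite mulrBr mulrA mulfV ?gt_eqF// mul1r; lra.
Qed.

(** Moving from [x0] to [x] lowers [M] at [z] by at most [w x * (1 + enorm z)], and coercivity
    bounds [enorm z] by [M x0 z + B]. So the infimum is at least [phi - w x * (1 + B + phi)],
    uniformly in [z]. *)
Lemma inf_affine_perturbation_lsc (a : 'rV[R]_n -> R) (b : 'rV[R]_n -> 'rV[R]_n)
    (k : 'rV[R]_n -> \bar R) (x0 : 'rV[R]_n) (B : R) :
  let M x z := ((a x + dotv (b x) z)%:E + k z)%E in
  a @ x0 --> a x0 -> b @ x0 --> b x0 ->
  (forall z, ((enorm z - B)%:E <= M x0 z)%E) ->
  ereal_inf (range (M x0)) \is a fin_num ->
  forall c, (c%:E < ereal_inf (range (M x0)))%E ->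
  \forall x \near x0, (c%:E < ereal_inf (range (M x)))%E.
Proof.
move=> M ca cb coer finM c cM.
set phi := fine (ereal_inf (range (M x0))).
have phiE : ereal_inf (range (M x0)) = phi%:E by rewrite fineK.
have phi_le z : (phi%:E <= M x0 z)%E.
  by rewrite -phiE; apply: ereal_inf_lbound; exists z.
have c_phi : c < phi by rewrite -lte_fin -phiE.
pose w x := `|a x - a x0| + enorm (b x - b x0).
have w0 x : 0 <= w x by rewrite addr_ge0 ?enorm_ge0.
have cw : w x @[x --> x0] --> 0.
  rewrite -[X in _ --> X](addr0 0).
  apply: (@cvgD R R _ (nbhs x0)).
    rewrite -[X in _ --> X](normr0 R) -[X in `|X|](subrr (a x0)).
    apply: cvg_norm.
    exact: (@cvgB R R _ (nbhs x0) _ a (cst (a x0)) _ _ ca (cvg_cst _)).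
  rewrite -[X in _ --> X](@enorm0 R n) -[X in enorm X](subrr (b x0)).
  apply: (@cvg_enorm _ _ _ (nbhs x0)).
  exact: (@cvgB R _ _ (nbhs x0) _ b (cst (b x0)) _ _ cb (cvg_cst _)).
(* The added 1 keeps [K] positive; [w x < del] then costs at most half of the gap [phi - c]. *)
pose K := `|1 + B + phi| + 1.
have K0 : 0 < K by rewrite ltr_wpDl.
pose del := (phi - c) / (2 * K).
have del0 : 0 < del by rewrite divr_gt0 ?mulr_gt0// subr_gt0.
have delK : del * K = (phi - c) / 2 by rewrite /del; field; rewrite gt_eqF.
near=> x.
have w1 : w x < 1 by near: x; exact: (cvgr_lt _ cw).
have wdel : w x < del by near: x; exact: (cvgr_lt _ cw).
apply: (@lt_le_trans _ _ ((c + phi) / 2)%:E); first by rewrite lte_fin; lra.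
apply: le_ereal_inf_tmp => _ [z _ <-]; move: (coer z) (phi_le z); rewrite /M.
case: (k z) => [s||]//=; last by move=> _ _; rewrite leey.
rewrite !lee_fin => zB phi_z.
set M0 := a x0 + _ + s in zB phi_z.
have wz : - (w x * (1 + enorm z)) <= a x - a x0 + dotv (b x - b x0) z.
  have := norm_dotv_le_enorm (b x - b x0) z; rewrite ler_norml => /andP[dot_ge _].
  have := ler_norm (- (a x - a x0)); rewrite normrN => a_ge.
  have := mulr_ge0 (normr_ge0 (a x - a x0)) (enorm_ge0 z).
  have := enorm_ge0 (b x - b x0).
  rewrite /w; lra.
have wK : w x * (1 + B + phi) <= (phi - c) / 2.
  rewrite -delK; apply: (@le_trans _ _ (w x * K)).
    by rewrite ler_wpM2l// /K; have := ler_norm (1 + B + phi); lra.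
  by rewrite ler_wpM2r ?ltW.
have wzB : w x * enorm z <= w x * (M0 + B) by rewrite ler_wpM2l//; lra.
have wphi : (1 - w x) * phi <= (1 - w x) * M0.
  by rewrite ler_wpM2l// subr_ge0 ltW.
move: wz; rewrite dotvBl; rewrite /M0 in wzB wphi *; lra.
Unshelve. all: by end_near.
Qed.

End Envelope.

(* In \bar R the library sets 0^-1 = +oo, so (Lf%:E)^-1 is 1/L_f with the
   convention 1/0 = +oo. *)
Theorem lemma5p11 (R : realType) (n : nat) (h f g : 'rV[R]_n -> \bar R)
    (Lf gamma : R) (xs : 'rV[R]_n) (psi : R -> R)
    (h_legendre : legendre_kernel h)
    (f_smooth : rel_smooth Lf f h)
    (g_proper : proper_fun g)
    (g_lsc : lower_semicontinuous g)
    (phi_argmin : argmin (closure (dom h)°) (fun x => f x + g x)%E !=set0)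
    (range_T : forall c : R, 0 < c -> (c%:E < (Lf%:E)^-1)%E ->
       forall x, bfb_map f g h c x `<=` (dom h)°)
    (gamma_gt0 : 0 < gamma)
    (gamma_lt : (gamma%:E < (Lf%:E)^-1)%E)
    (xs_fix : bfb_map f g h gamma xs = [set xs])
    (g_prox_regular : prox_regular g xs (- grad f xs))
    (f_C2 : C2_on (dom h)° (fine \o f))
    (h_C2 : C2_on (dom h)° (fine \o h))
    (h_hess : forall x : 'rV[R]_n, (dom h)° x -> posdefmx (hess h x))
    (env_KL : KL_property (bfb_envelope f g h gamma) xs psi) :
  exists eps eta : R, [/\ 0 < eps, 0 < eta &
    forall x, eball xs eps x ->
      (bfb_envelope f g h gamma xs < bfb_envelope f g h gamma x)%E ->
      (bfb_envelope f g h gamma x < bfb_envelope f g h gamma xs + eta%:E)%E ->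
      (set_dist x (sublevel (bfb_envelope f g h gamma)
                            (bfb_envelope f g h gamma xs))
       <= (psi (fine (bfb_envelope f g h gamma x
                      - bfb_envelope f g h gamma xs)%E))%:E)%E].
Proof.
have [hprop _ _ _ hC1 _ _ _] := h_legendre.
have [_ fprop _ hf _ _] := f_smooth.
have fC1 : C1_on (dom h)° (fine \o f) by case: f_C2.
have Txs : bfb_map f g h gamma xs xs by rewrite xs_fix.
have xsC : (dom h)° xs by exact: range_T Txs.
have [_ Mxs _] := Txs.
pose k z := (g z + (gamma^-1)%:E * h z)%E.
pose a := envelope_offset f h gamma; pose b := envelope_slope f h gamma.
have fin_h x : (dom h)° x -> h x \is a fin_num.
  by move=> /interior_subset; exact: proper_fun_fin_num.
have fin_f x : (dom h)° x -> f x \is a fin_num.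
  by move=> /interior_subset/hf; exact: proper_fun_fin_num.
have ME x z : (dom h)° x ->
    bfb_model f g h gamma x z = ((a x + dotv (b x) z)%:E + k z)%E.
  by move=> xC; apply: bfb_modelE => //; [exact: fin_f|exact: fin_h|
    case: g_proper|case: hprop].
have PhiE x : (dom h)° x ->
    bfb_envelope f g h gamma x = ereal_inf (range (fun z => (a x + dotv (b x) z)%:E + k z)%E).
  move=> xC; rewrite /bfb_envelope.
  suff -> : bfb_model f g h gamma x =
    (fun z => (a x + dotv (b x) z)%:E + k z)%E by [].
  by apply/funext => z; exact: ME.
(* Evaluating any model at [xs] thus bounds the envelope above on the whole interior. *)
have kxs : (k xs < +oo)%E.
  by move: Mxs; rewrite ME//; case: (k xs) => [s||]//= _; rewrite ltry.
have coer x : (dom h)° x ->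
    exists B, forall z, ((enorm z - B)%:E <= (a x + dotv (b x) z)%:E + k z)%E.
  move=> xC; have [B BM] := bfb_model_coercive _ _ _ _ _ _ h_legendre f_smooth fC1
    g_proper phi_argmin gamma_gt0 gamma_lt xC.
  by exists B => z; rewrite -ME.
have Phi_fin x : (dom h)° x -> bfb_envelope f g h gamma x \is a fin_num.
  move=> xC; have [B BM] := coer x xC; rewrite PhiE// fin_numElt; apply/andP; split.
    apply: (@lt_le_trans _ _ (- B)%:E); first by rewrite ltNyr.
    apply: le_ereal_inf_tmp => _ [z _ <-]; apply: le_trans (BM z).
    by rewrite lee_fin lerDr enorm_ge0.
  apply: (@le_lt_trans _ _ ((a x + dotv (b x) xs)%:E + k xs)%E).
    by apply: ereal_inf_lbound; exists xs.
  by rewrite lte_add_pinfty// ltry.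
(* Neighbourhoods come as max-norm balls; a Euclidean ball of the same radius is smaller. *)
have [rho /= rho0 rhoC] : exists2 rho : R, 0 < rho & eball xs rho `<=` (dom h)°.
  have [rho /= rho0 rhoC] : nbhs_ball xs (dom h)°.
    by apply/nbhs_ballP; exact: nbhs_interior.
  exists rho => // y yxs; apply: rhoC; rewrite mx_norm_ball /ball_ /= distrC.
  exact: le_lt_trans (norm_le_enorm _) yxs.
apply: (KL_error_bound _ _ _ rho) env_KL => //.
  by move=> u /rhoC; exact: Phi_fin.
move=> u c /rhoC uC; have := Phi_fin u uC; rewrite PhiE// => inf_fin ltc.
have [B BM] := coer u uC.
have lsc_u := inf_affine_perturbation_lsc a b k u B
  (cvg_envelope_offset _ _ _ _ _ fC1 hC1 uC)
  (cvg_envelope_slope _ _ _ _ _ fC1 hC1 uC) BM inf_fin c ltc.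
near=> z; have zC : (dom h)° z by near: z; exact: nbhs_interior.
by rewrite (PhiE _ zC); near: z; exact: lsc_u.
Unshelve. all: by end_near.
Qed.
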